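(* Let $\mathcal{T}$ be a tree and let $k\in\mathbb{N}$. Suppose that $G\leq\mathrm{Aut}(\mathcal{T})$ does not stabilise a proper non-empty subtree of $\mathcal{T}$, does not stabilise an end of $\mathcal{T}$, and satisfies Property $P_k$. Then every nontrivial subgroup of $G$ that is normalised by $G^{+_k}$ contains $G^{+_k}$; in particular $G^{+_k}$ is (abstractly) simple or trivial.
   Context: All trees are locally finite simple graphs; $\mathbb{N}=\{1,2,3,\dots\}$. $\mathrm{Aut}(\mathcal{T})$ is the group of graph automorphisms (edge-inversions are allowed), $d$ is the graph metric, and $B(v,r)$ is the subtree formed by the closed ball of radius $r$ about the vertex $v$. $E(\mathcal{T})$ is the set of directed edges $(v,w)$, i.e. ordered pairs of adjacent vertices. $\mathrm{Fix}_G(Y)$ is the set of $g\in G$ fixing every vertex of $Y$; $G$ stabilises a subtree $Y$ if $g(Y)=Y$ for all $g\in G$. Paths have no backtracking and may be finite, infinite (in one direction) or doubly-infinite. An end of $\mathcal{T}$ is an equivalence class of (one-way) infinite paths, two such paths being equivalent iff their intersection is an infinite path; the members of the class are the representatives of the end. $G$ stabilises an end $b$ if every $g\in G$ maps representatives of $b$ to representatives of $b$. For a subtree $X$ of $\mathcal{T}$, $X^r$ is the subtree spanned by the vertices at distance at most $r$ from $X$. Property $P_k$: for a path $C$ in $\mathcal{T}$ (finite, infinite or doubly-infinite), let $\pi:V(\mathcal{T})\to V(C)$ send each vertex to the closest vertex of $C$, and for $x\in V(C)$ let $F_x$ be the permutation group on $\pi^{-1}(x)$ induced by the action of $\mathrm{Fix}_G(C^{k-1})$.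 $G$ satisfies Property $P_k$ iff for every such $C$ the natural homomorphism $\Phi:\mathrm{Fix}_G(C^{k-1})\to\prod_{x\in V(C)}F_x$ is an isomorphism. $G^{+_k}$ is the subgroup of $G$ generated by all $g\in G$ for which there exists $(v,w)\in E(\mathcal{T})$ such that $g$ fixes $B(v,k)\cap B(w,k)$ pointwise. *)

(* Defs.v *)
From HB Require Import structures.
From mathcomp Require Import all_boot all_order all_algebra.
From mathcomp Require Import all_classical.

Set Implicit Arguments.
Unset Strict Implicit.
Unset Printing Implicit Defensive.

Local Open Scope classical_set_scope.
Local Open Scope group_scope.

(* Subgroups of gT : groupType are the library's groupClosed gT. *)

Section Subgroups.
Variable gT : groupType.

(* The subgroup H as an abstract group. *)
Definition elt (H : groupClosed gT) := {x : gT | x \in H}.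

HB.instance Definition _ (H : groupClosed gT) := [isSub of elt H for sval].
HB.instance Definition _ (H : groupClosed gT) := [Choice of elt H by <:].

Fact groupClosed_closed (H : groupClosed gT) : group_closed H.
Proof. by split; [exact: gpred1 | exact: gpredF]. Qed.

HB.instance Definition _ (H : groupClosed gT) :=
  SubChoice_isSubGroup.Build gT _ (elt H) (groupClosed_closed H).

Definition trivial_group := forall x : gT, x = 1.

(* H normalises K: K ^ g = K for all g in H. *)
Definition normalised_by (K H : {pred gT}) :=
  forall g h, g \in H -> (h ^ g \in K) = (h \in K).

Definition simple_group :=
  ~ trivial_group /\
  forall N : groupClosed gT, normalised_by N predT ->
    (forall x, x \in N -> x = 1) \/ (forall x, x \in N).

Definition generated (S : set gT) : {pred gT} :=
  [pred g | `[< forall H : groupClosed gT, (forall x, S x -> x \in H) -> g \in H >]].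

Fact generated_closed S : group_closed (generated S).
Proof.
split=> [|x y /asboolP Sx /asboolP Sy]; apply/asboolP => H SH.
  exact: gpred1.
by rewrite gpredF ?Sx ?Sy.
Qed.

HB.instance Definition _ S :=
  isMulClosed.Build gT (generated S) (group_closedM (generated_closed S)).
HB.instance Definition _ S :=
  isMul1Closed.Build gT (generated S) (generated_closed S).1.
HB.instance Definition _ S :=
  isInvClosed.Build gT (generated S) (group_closedV (generated_closed S)).

End Subgroups.

Definition group_isomorphism (gT hT : groupType) (f : gT -> hT) :=
  {morph f : x y / x * y} /\ bijective f.

(* The (unrestricted) direct product, with pointwise operations. *)
Section Product.
Variables (I : Type) (gT : I -> groupType).
Implicit Types f g h : forall i, gT i.

Definition dprod_one : forall i, gT i := fun=> 1.
Definition dprod_inv f : forall i, gT i := fun i => (f i)^-1.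
Definition dprod_mul f g : forall i, gT i := fun i => f i * g i.

Fact dprod_mulA : associative dprod_mul.
Proof. by move=> f g h; apply: functional_extensionality_dep => i; exact: mulgA. Qed.
Fact dprod_mul1 : left_id dprod_one dprod_mul.
Proof. by move=> f; apply: functional_extensionality_dep => i; exact: mul1g. Qed.
Fact dprod_mulr1 : right_id dprod_one dprod_mul.
Proof. by move=> f; apply: functional_extensionality_dep => i; exact: mulg1. Qed.
Fact dprod_mulV : left_inverse dprod_one dprod_inv dprod_mul.
Proof. by move=> f; apply: functional_extensionality_dep => i; exact: mulVg. Qed.
Fact dprod_mulrV : right_inverse dprod_one dprod_inv dprod_mul.
Proof. by move=> f; apply: functional_extensionality_dep => i; exact: mulgV. Qed.

HB.instance Definition _ := isGroup.Build (forall i, gT i)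
  dprod_mulA dprod_mul1 dprod_mulr1 dprod_mulV dprod_mulrV.
End Product.

(* The symmetric group on an arbitrary type; f * g applies g first. *)
Record sym (X : Type) := Sym {
  sym_fun :> X -> X;
  sym_inv : X -> X;
  symK : cancel sym_fun sym_inv;
  symVK : cancel sym_inv sym_fun
}.

Section Sym.
Variable X : Type.
Implicit Types f g h : sym X.

Lemma sym_ext f g : f =1 g -> f = g.
Proof.
case: f g => [f f' fK f'K] [g g' gK g'K] /= /funext fg; subst g.
have E : f' = g' by apply: funext => x; rewrite -{1}(g'K x) fK.
by subst g'; congr Sym; exact: Prop_irrelevance.
Qed.

Definition sym_one : sym X := @Sym X id id (fun=> erefl) (fun=> erefl).
Definition sym_inverse f : sym X := Sym (symVK f) (symK f).
Definition sym_mul f g : sym X :=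
  Sym (can_comp (symK f) (symK g)) (can_comp (symVK g) (symVK f)).

Fact sym_mulA : associative sym_mul.
Proof. by move=> f g h; exact: sym_ext. Qed.
Fact sym_mul1 : left_id sym_one sym_mul.
Proof. by move=> f; exact: sym_ext. Qed.
Fact sym_mulr1 : right_id sym_one sym_mul.
Proof. by move=> f; exact: sym_ext. Qed.
Fact sym_mulV : left_inverse sym_one sym_inverse sym_mul.
Proof. by move=> f; apply: sym_ext => x; exact: symK. Qed.
Fact sym_mulrV : right_inverse sym_one sym_inverse sym_mul.
Proof. by move=> f; apply: sym_ext => x; exact: symVK. Qed.

HB.instance Definition _ := gen_eqMixin (sym X).
HB.instance Definition _ := gen_choiceMixin (sym X).
HB.instance Definition _ :=
  isGroup.Build (sym X) sym_mulA sym_mul1 sym_mulr1 sym_mulV sym_mulrV.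
End Sym.

(* The empty graph is not excluded. *)
Record tree := Tree {
  vert :> choiceType;
  adj : rel vert;
  adj_sym : symmetric adj;
  adj_irr : irreflexive adj;
  adj_lf : forall v, finite_set [set w | adj v w];
  adj_conn : forall u v, exists2 p, path adj u p & last u p = v;
  adj_acyclic : forall c, ucycle adj c -> size c < 3
}.
Arguments adj {t}.

Section Tree.
Variable T : tree.
Implicit Types (u v w x : T) (Y C : set T).

Fact walk_length_exists u v :
  exists n, `[< exists p, [/\ path adj u p, last u p = v & size p = n] >].
Proof.
by have [p up pv] := adj_conn u v; exists (size p); apply/asboolP; exists p.
Qed.

Definition dist u v : nat := ex_minn (walk_length_exists u v).

Definition ball v r : set T := [set w | dist v w <= r].

(* A subgraph that is a tree is induced, so it is given by its vertices. *)
Definition subtree Y :=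
  forall u v, Y u -> Y v ->
    exists p, [/\ path adj u p, last u p = v & forall w, w \in p -> Y w].

Definition nbhd Y r : set T := [set v | exists2 x, Y x & dist v x <= r].

(* The path c 0, ..., c n; the values c i for i > n are irrelevant. *)
Definition finite_path (n : nat) (c : nat -> T) :=
  (forall i, i < n -> adj (c i) (c i.+1)) /\
  (forall i, i.+1 < n -> c i != c i.+2).

Definition infinite_path (c : nat -> T) :=
  forall i, adj (c i) (c i.+1) /\ c i != c i.+2.

Definition biinfinite_path (c : int -> T) :=
  forall i, adj (c i) (c (i + 1)%R) /\ c i != c (i + 2)%R.

Definition path_vertices C :=
  [\/ exists n c, finite_path n c /\ C = [set c i | i in [set i | i <= n]],
      exists c, infinite_path c /\ C = range c
    | exists c, biinfinite_path c /\ C = range c].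

(* Both paths are induced subgraphs, so their intersection is given by its
   vertices. *)
Definition end_equiv (c c' : nat -> T) :=
  exists c'', infinite_path c'' /\ range c'' = range c `&` range c'.

Definition is_end (b : set (nat -> T)) :=
  exists2 c, infinite_path c &
    b = [set c' | infinite_path c' /\ end_equiv c c'].

(* The closest vertex of C to v; it is unique when C is the vertex set of a
   non-empty subtree, and v is a dummy value for empty C. *)
Definition closest_vertex C v : T :=
  xget v [set x | C x /\ forall y, C y -> dist v x <= dist v y].

Definition fibre C x : set T := [set v | closest_vertex C v = x].

Definition is_aut : {pred sym T} :=
  [pred g : sym T | `[< forall u v, adj (g u) (g v) = adj u v >]].

Fact is_aut_closed : group_closed is_aut.
Proof.
split=> [|f g /asboolP autf /asboolP autg]; apply/asboolP => // u v.
by rewrite -[u in RHS](symVK g) -[v in RHS](symVK g) autg; exact: autf.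
Qed.

HB.instance Definition _ :=
  isMulClosed.Build (sym T) is_aut (group_closedM is_aut_closed).
HB.instance Definition _ := isMul1Closed.Build (sym T) is_aut is_aut_closed.1.
HB.instance Definition _ :=
  isInvClosed.Build (sym T) is_aut (group_closedV is_aut_closed).

Definition aut := elt is_aut.
HB.instance Definition _ := Group.on aut.
Definition aut_fun (g : aut) : T -> T := sym_fun (val g).

End Tree.

Coercion aut_fun : aut >-> Funclass.

Section AutTheory.
Variable T : tree.
Implicit Types (g h : aut T) (C : set T).

Lemma autM g h v : (g * h : aut T) v = g (h v). Proof. by []. Qed.

Lemma aut_adj g u v : adj (g u) (g v) = adj u v.
Proof. by have /asboolP := valP g; apply. Qed.

Lemma autK g : cancel g (g^-1%g : aut T).
Proof. by move=> v; exact: (symK (val g)). Qed.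

Lemma autVK g : cancel (g^-1%g : aut T) g.
Proof. by move=> v; exact: (symVK (val g)). Qed.

Lemma dist_min u (p : seq T) : path adj u p -> dist u (last u p) <= size p.
Proof.
by move=> up; rewrite /dist; case: ex_minnP => m _; apply; apply/asboolP; exists p.
Qed.

Lemma dist_path (u v : T) :
  exists p, [/\ path adj u p, last u p = v & size p = dist u v].
Proof. by rewrite /dist; case: ex_minnP => m /asboolP. Qed.

Lemma aut_dist g u v : dist (g u) (g v) = dist u v.
Proof.
have le h x y : dist (h x) (h y) <= dist x y.
  have [p [xp <- <-]] := dist_path x y; rewrite -last_map -(size_map h).
  apply: dist_min; rewrite path_map.
  by apply: sub_path xp => a b; rewrite /relpre /= aut_adj.
apply/eqP; rewrite eqn_leq le /=.
by rewrite -[X in dist X _ <= _](autK g) -[X in dist _ X <= _](autK g) le.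
Qed.

Lemma dist0 (v : T) : dist v v = 0.
Proof. by apply/eqP; rewrite -leqn0; exact: (@dist_min v [::]). Qed.

Lemma sub_nbhd C r : C `<=` nbhd C r.
Proof. by move=> x Cx; exists x; rewrite // dist0. Qed.

Lemma aut_fibre g C x v : C x -> (forall y, C y -> g y = y) ->
  fibre C x v -> fibre C x (g v).
Proof.
rewrite /fibre /= /closest_vertex => Cx gC.
have -> : [set y | C y /\ forall z, C z -> dist (g v) y <= dist (g v) z] =
          [set y | C y /\ forall z, C z -> dist v y <= dist v z].
  have E y : C y -> dist (g v) y = dist v y by move=> Cy; rewrite -{1}(gC y Cy) aut_dist.
  apply/seteqP; split=> y /= [Cy yP]; split=> // z Cz.
    by rewrite -!E // yP.
  by rewrite !E // yP.
rewrite /xget; case: pselect => // _ vx; rewrite vx; exact: gC.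
Qed.

End AutTheory.

Section Groups.
Variables (T : tree) (G : groupClosed (aut T)).
Implicit Types (C Y : set T) (b : set (nat -> T)).

Definition stabilises_subtree Y := forall g : aut T, g \in G -> g @` Y = Y.

Definition stabilises_end b :=
  forall g : aut T, g \in G -> forall c, b c -> b (g \o c).

Definition fixer Y : {pred aut T} :=
  [pred g : aut T | (g \in G) && `[< forall v, Y v -> g v = v >]].

Fact fixer_closed Y : group_closed (fixer Y).
Proof.
split=> [|f g]; first by rewrite inE gpred1; apply/asboolP.
rewrite !inE => /andP[Gf /asboolP Yf] /andP[Gg /asboolP Yg].
rewrite gpredF //; apply/asboolP => v Yv.
by rewrite autM -{1}(Yg v Yv) autK Yf.
Qed.

HB.instance Definition _ Y :=
  isMulClosed.Build (aut T) (fixer Y) (group_closedM (fixer_closed Y)).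
HB.instance Definition _ Y :=
  isMul1Closed.Build (aut T) (fixer Y) (fixer_closed Y).1.
HB.instance Definition _ Y :=
  isInvClosed.Build (aut T) (fixer Y) (group_closedV (fixer_closed Y)).

Section Restriction.
Variables (C : set T) (r : nat).

Let FixG := elt (fixer (nbhd C r)).

Fact fixer_fibre (g : FixG) (x : C) v :
  v \in fibre C (val x) -> aut_fun (val g) v \in fibre C (val x).
Proof.
case: g => g /= /andP[_ /asboolP gC] /set_mem vx; apply/mem_set.
apply: aut_fibre vx; first exact: set_mem (valP x).
by move=> y Cy; apply: gC; exact: sub_nbhd.
Qed.

Definition restr_fun (g : FixG) (x : C) (v : fibre C (val x)) :
  fibre C (val x) := exist _ (aut_fun (val g) (val v)) (fixer_fibre g (valP v)).

Fact restrK (g : FixG) x : cancel (@restr_fun g x) (@restr_fun g^-1%g x).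
Proof. by move=> v; apply: val_inj; exact: (autK (val g)). Qed.

Fact restrVK (g : FixG) x : cancel (@restr_fun g^-1%g x) (@restr_fun g x).
Proof. by move=> v; apply: val_inj; exact: (autVK (val g)). Qed.

Definition restr (g : FixG) (x : C) : sym (fibre C (val x)) :=
  Sym (@restrK g x) (@restrVK g x).

Fact restrM x : {morph restr^~ x : g h / g * h}.
Proof. by move=> g h; apply: sym_ext => v; exact: val_inj. Qed.

(* F_x, for the pointwise fixer of C^r. *)
Definition fibre_group (x : C) : {pred sym (fibre C (val x))} :=
  [pred f | `[< exists g, restr g x = f >]].
Arguments fibre_group : clear implicits.

Fact fibre_group_closed x : group_closed (fibre_group x).
Proof.
have r1 : restr 1 x = 1 by apply: sym_ext => v; exact: val_inj.
split=> [|f1 f2 /asboolP[g1 <-] /asboolP[g2 <-]]; apply/asboolP.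
  by exists 1.
exists (g1 / g2); rewrite restrM; congr (_ * _).
by apply: (mulIg (restr g2 x)); rewrite -restrM !mulVg.
Qed.

HB.instance Definition _ x :=
  isMulClosed.Build _ (fibre_group x) (group_closedM (fibre_group_closed x)).
HB.instance Definition _ x :=
  isMul1Closed.Build _ (fibre_group x) (fibre_group_closed x).1.
HB.instance Definition _ x :=
  isInvClosed.Build _ (fibre_group x) (group_closedV (fibre_group_closed x)).

Fact restr_in (g : FixG) x : restr g x \in fibre_group x.
Proof. by apply/asboolP; exists g. Qed.

Definition Phi (g : FixG) : forall x : C, elt (fibre_group x) :=
  fun x => exist _ (restr g x) (restr_in g x).

End Restriction.

(* k >= 1 is assumed where this is used; for k = 0, k.-1 is 0. *)
Definition property_P (k : nat) :=
  forall C, path_vertices C -> group_isomorphism (@Phi C k.-1).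

Definition Gplus (k : nat) : {pred aut T} :=
  generated [set g : aut T | g \in G /\
    exists v w, adj v w /\ forall u, (ball v k `&` ball w k) u -> g u = u].

HB.instance Definition _ k := GroupClosed.on (Gplus k).

End Groups.

Arguments fibre_group {T} G C r x.

(* Main.v *)
(* Write A* for the complement of a half-tree A (one side of an edge). If no m
   in G maps A* into A, then the translates of A* meet pairwise: their common
   vertices form a proper G-invariant subtree, or, if there are none, each
   vertex has a unique neighbour towards the translates missing it, and
   following these neighbours gives a G-invariant end. So G maps every A* into A
   and, half-trees being nested, every half-tree into every other.
   Suppose G^{+_k} is nontrivial; then T has a vertex of degree at least 3. If M
   maps every half-tree into every other and N is nontrivial and normalised by
   M, then some n in N has nD disjoint from D for a half-tree D, and conjugating
   n by M gives N the same property. If moreover m in M maps D* strictly inside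
   D, then n m n^-1 m^-1 in N maps nD strictly into itself, so it is a
   translation along an axis; conjugating it by M moves the axis into any
   prescribed half-tree.
   Apply this to G^{+_k} in G, then to H in G^{+_k}. By property P_k for an
   edge, G^{+_k} is generated by elements g fixing a half-tree A and the
   (k-1)-neighbourhood of its edge. Let h in H translate along an axis C inside
   A. Then g fixes C^{k-1}, and property P_k for C gives f in Fix(C^{k-1}) with
   f h f^-1 = g^-1 h, so that g = [h, f] lies in H. *)
From HB Require Import structures.
Require Import Defs.
From mathcomp Require Import all_boot all_order all_algebra.
From mathcomp Require Import all_classical.
From mathcomp Require Import zify.

Set Implicit Arguments.
Unset Strict Implicit.
Unset Printing Implicit Defensive.

Import Order.TTheory GRing.Theory Num.Theory.

Local Open Scope classical_set_scope.

(** * Distances and half-trees *)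

Lemma path_reverse (X : Type) (e : rel X) x p : symmetric e -> path e x p ->
  exists q, [/\ path e (last x p) q, last (last x p) q = x & size q = size p].
Proof.
move=> eC xp; exists (rev (belast x p)); split.
- by rewrite rev_path (eq_path (fun a b => eC b a)).
- by case: p {xp} => //= a p; rewrite rev_cons last_rcons.
- by rewrite size_rev size_belast.
Qed.

Section Metric.
Variable T : tree.
Implicit Types u v w x y z a b : T.

Lemma dist_eq0 u v : dist u v = 0 -> u = v.
Proof.
move=> E; have [p [_ pv]] := dist_path u v; rewrite E => /size0nil p0.
by rewrite p0 in pv.
Qed.

Lemma dist_triangle u v w : dist u w <= dist u v + dist v w.
Proof.
have [p [up pv <-]] := dist_path u v; have [q [vq <- <-]] := dist_path v w.
by rewrite -size_cat -pv -last_cat dist_min // cat_path up pv.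
Qed.

Lemma dist_le_sym u v : dist u v <= dist v u.
Proof.
have [p [vp pu <-]] := dist_path v u.
have [q [+ + <-]] := path_reverse (@adj_sym T) vp.
by rewrite pu => /dist_min uq qv; rewrite qv in uq.
Qed.

Lemma distC u v : dist u v = dist v u.
Proof. by apply/eqP; rewrite eqn_leq !dist_le_sym. Qed.

Lemma adj_neq u v : adj u v -> u != v.
Proof. by apply: contraTN => /eqP ->; rewrite adj_irr. Qed.

Lemma dist_adj u v : adj u v -> dist u v = 1.
Proof.
move=> uv; apply/eqP; rewrite eqn_leq (@dist_min _ u [:: v]) /= ?uv //.
by rewrite lt0n; apply: contra (adj_neq uv) => /eqP/dist_eq0 ->.
Qed.

Lemma adj_step u v : u <> v -> exists2 w, adj u w & dist u v = (dist w v).+1.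
Proof.
have [p [up pv E]] := dist_path u v.
case: p up pv E => [_ /= -> //|w p /= /andP[uw wp] pv E _]; exists w => //.
have := dist_triangle u w v; rewrite (dist_adj uw) -E.
by have := dist_min wp; rewrite pv; lia.
Qed.

(** For an edge, this is the component of [y] once the edge is removed; the metric form makes it
    visibly equivariant under automorphisms. *)
Definition halftree x y : set T := [set z | dist z y < dist z x].

Definition other_edge x y : rel T :=
  fun a b => [&& adj a b, (a, b) != (x, y) & (a, b) != (y, x)].

(** A simple path from [x] to [y] avoiding the edge would close up with it to a cycle of length at
    least 3. *)
Lemma edge_separates x y p :
  adj x y -> path (other_edge x y) x p -> last x p <> y.
Proof.
move=> xy; case/shortenP=> q xq uq _ qy.
have sub : subrel (other_edge x y) adj by move=> a b /and3P[].
suff q2 : size q >= 2.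
  suff: ucycle adj (x :: q) by move=> /adj_acyclic; rewrite /= ltnS ltnNge q2.
  by rewrite /ucycle uq andbT /= rcons_path (sub_path sub xq) qy adj_sym.
case: q xq qy {uq} => [|a [|b q]] //=.
  by move=> _ E; move: (adj_neq xy); rewrite E eqxx.
by move=> /[swap] ->; rewrite /other_edge eqxx andbF.
Qed.

(** If a geodesic from [b] to [u] met [a], the part after [a] would make [u] closer to [a] than to
    [b]. *)
Lemma geodesic_avoids a b u :
  adj a b -> dist u b <= dist u a ->
  exists2 p, path (other_edge a b) b p & last b p = u.
Proof.
move=> ab le; have [p [bp pu E]] := dist_path b u; exists p => //.
apply: (@sub_in_path _ (predC1 a) adj) (bp) => [s t|].
  rewrite !inE /other_edge => sa ta -> /=; rewrite !xpair_eqE.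
  by rewrite (negbTE sa) (negbTE ta) andbF.
apply/allP => t; rewrite !inE => tp; apply/eqP => ta; subst t.
case/orP: tp => [/eqP ba|ap]; first by rewrite ba adj_irr in ab.
case/splitPr: ap bp pu E => p1 p2; rewrite cat_path last_cat size_cat /=.
move=> /and3P[_ _ /dist_min ap2] pu E; rewrite pu in ap2.
by move: (distC b u) (distC a u); lia.
Qed.

Lemma other_edge_sym x y : symmetric (other_edge x y).
Proof.
move=> a b; rewrite /other_edge adj_sym !xpair_eqE.
by congr (_ && _); rewrite [RHS]andbC [(b == x) && _]andbC [(b == y) && _]andbC.
Qed.

Lemma other_edgeC x y : other_edge x y =2 other_edge y x.
Proof. by move=> a b; congr (_ && _); exact: andbC. Qed.

(** Otherwise geodesics from [y] to [z] and from [z'] to [x], joined by the edge from [z] to [z'],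
    would bypass the edge [(x, y)]. *)
Lemma halftree_cut x y z z' :
  adj x y -> adj z z' -> halftree x y z -> ~ halftree x y z' -> z = y /\ z' = x.
Proof.
rewrite /halftree /= => xy zz' zy /negP; rewrite -leqNgt => z'x.
apply: contrapT => ne.
have zz'E : other_edge x y z z'.
  rewrite /other_edge zz' !xpair_eqE /=.
  apply/andP; split; apply/negP => /andP[/eqP zE /eqP z'E].
    by rewrite zE dist0 in zy.
  by case: ne.
have [p yp pz] := geodesic_avoids xy (ltnW zy).
have [q xq qz'] := geodesic_avoids (etrans (adj_sym y x) xy) z'x.
have [q' [+ + _]] := path_reverse (other_edge_sym y x) xq.
rewrite qz' => z'q' q'x.
apply: (@edge_separates y x (p ++ z' :: q')); first by rewrite adj_sym.
  rewrite cat_path pz /= z'q' other_edgeC zz'E andbT.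
  by rewrite (eq_path (other_edgeC y x)) yp.
by rewrite last_cat.
Qed.

(* Half-trees of opposite edges are complementary: a vertex equidistant from x
   and y would yield a second route from x to y. *)
Lemma halftree_notin x y z : adj x y -> ~ halftree x y z -> halftree y x z.
Proof.
rewrite /halftree /= => xy /negP; rewrite -leqNgt leq_eqVlt => /orP[/eqP E|//].
have [p xp pz] := geodesic_avoids (etrans (adj_sym y x) xy) (eq_leq E).
have [q yq qz] := geodesic_avoids xy (eq_leq (esym E)).
have [q' [+ + _]] := path_reverse (other_edge_sym x y) yq.
rewrite qz => zq' q'y; exfalso.
apply: (@edge_separates x y (p ++ q')) => //; last by rewrite last_cat pz.
by rewrite cat_path pz zq' (eq_path (other_edgeC x y)) xp.
Qed.

Lemma halftree_notin_opp x y z : halftree y x z -> ~ halftree x y z.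
Proof. by rewrite /halftree /= => ? ?; lia. Qed.

Lemma halftree_head x y : adj x y -> halftree x y y.
Proof. by move=> xy; rewrite /halftree /= dist0 distC dist_adj. Qed.

(** By [halftree_cut] a path can leave the half-tree only by stepping from [y] to [x]. *)
Lemma dist_cross x y u w : adj x y -> halftree x y u -> halftree y x w ->
  dist u w = (dist u y + dist x w).+1.
Proof.
move=> xy xyu yxw.
have cross p v : path adj v p -> halftree x y v -> last v p = w ->
    (dist v y + dist x w).+1 <= size p.
  elim: p v => [|v' p IH] v /=.
    by move=> _ xyv vw; rewrite vw in xyv; case: (halftree_notin_opp yxw xyv).
  case/andP=> vv' v'p xyv lw.
  have [xyv'|nxyv'] := EM (halftree x y v').
    have := IH _ v'p xyv' lw; have := dist_triangle v v' y.
    by rewrite (dist_adj vv'); lia.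
  have [-> E] := halftree_cut xy vv' xyv nxyv'.
  by have := dist_min v'p; rewrite lw E dist0; lia.
have [p [up pw E]] := dist_path u w.
have := dist_triangle u x w; have := dist_triangle u y x.
rewrite [dist y x]distC (dist_adj xy).
have := dist_min up; have := cross _ _ up xyu pw; rewrite pw E; lia.
Qed.
End Metric.

(** * Half-trees under automorphisms: nesting and transport *)

Section Halves.
Variable T : tree.
Implicit Types (u v w x y z a b : T) (g m n : aut T).
Implicit Types (M N : groupClosed (aut T)).

Lemma adjC u v : adj u v -> adj v u.
Proof. by rewrite adj_sym. Qed.

Lemma aut_halftree g x y z : halftree (g x) (g y) (g z) <-> halftree x y z.
Proof. by rewrite /halftree /= !aut_dist. Qed.

Lemma aut_adjP g u v : adj u v -> adj (g u) (g v).
Proof. by rewrite aut_adj. Qed.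

Lemma dist_halftree x y z :
  adj x y -> halftree x y z -> dist z x = (dist z y).+1.
Proof.
move=> xy xyz.
by rewrite (dist_cross xy xyz (halftree_head (adjC xy))) dist0 addn0.
Qed.

Lemma halftree_toward x z : x <> z -> exists2 y, adj x y & halftree x y z.
Proof.
move/adj_step=> [y xy E]; exists y => //.
by rewrite /halftree /= distC [dist z x]distC E.
Qed.

(** A neighbour [y'] of [x] lying across the edge [(x, y)] from [z] is farther from [z] than [x]
    is. *)
Lemma halftree_step x y y' z :
  adj x y -> adj x y' -> halftree x y z -> halftree x y' z -> y = y'.
Proof.
move=> xy xy' hy hy'; have [E|] := EM (halftree x y y').
  have [] // := halftree_cut xy (adjC xy') E.
  by move=> H; exact: (halftree_notin_opp (halftree_head (adjC xy)) H).
move/(halftree_notin xy)/(dist_cross xy hy); rewrite (dist_adj xy').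
have := dist_halftree xy' hy'; have := dist_halftree xy hy; lia.
Qed.

(** The complement [halftree y x] contains neither [a] nor [b], so it lies on one side of their
    edge; the other side is then inside [halftree x y]. *)
Lemma halftree_nested x y a b :
  adj x y -> adj a b -> halftree x y a -> halftree x y b ->
  halftree b a `<=` halftree x y \/ halftree a b `<=` halftree x y.
Proof.
move=> xy ab xya xyb.
have side z : halftree y x z -> (halftree a b z <-> halftree a b y).
  rewrite /halftree /= => yxz; rewrite (dist_cross (adjC xy) yxz xya).
  by rewrite (dist_cross (adjC xy) yxz xyb) ltnS ltn_add2l.
have [aby|naby] := EM (halftree a b y).
  left=> z baz; apply: contrapT => /(halftree_notin xy) /side [_ /(_ aby)].
  exact: halftree_notin_opp.
by right=> z abz; apply: contrapT => /(halftree_notin xy) /side [/(_ abz)].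
Qed.

Lemma halftree_comparable x y a b : adj x y -> adj a b ->
  [\/ halftree a b `<=` halftree x y, halftree b a `<=` halftree x y,
      halftree a b `<=` halftree y x | halftree b a `<=` halftree y x].
Proof.
move=> xy ab; have [xya|/(halftree_notin xy) yxa] := EM (halftree x y a);
  have [xyb|/(halftree_notin xy) yxb] := EM (halftree x y b).
- by have [] := halftree_nested xy ab xya xyb; [constructor 2|constructor 1].
- have [-> ->] := halftree_cut xy ab xya (halftree_notin_opp yxb).
  by constructor 2.
- have [-> ->] := halftree_cut (adjC xy) ab yxa (halftree_notin_opp xyb).
  by constructor 1.
- have [] := halftree_nested (adjC xy) ab yxa yxb;
    by [constructor 4|constructor 3].
Qed.

Definition flips M := forall x y, adj x y ->
  exists2 m : aut T, m \in M & forall z, halftree y x z -> halftree x y (m z).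

Definition transports M := forall x y a b, adj x y -> adj a b ->
  exists2 m : aut T, m \in M & forall z, halftree a b z -> halftree x y (m z).

Lemma flips_transports M : flips M -> transports M.
Proof.
move=> fM x y a b xy ab.
have [h Mh hP] := fM _ _ xy; have [m Mm mP] := fM _ _ (adjC ab).
case: (halftree_comparable xy ab) => S.
- by exists 1%g; [exact: gpred1 | move=> z /S].
- by exists m => // z /mP /S.
- by exists h => // z /S /hP.
- by exists (h * m)%g; [exact: gpredM | move=> z /mP /S /hP].
Qed.

Definition branch_vertex u := exists y1 y2 y3,
  [/\ adj u y1, adj u y2, adj u y3, y1 <> y2 & y1 <> y3 /\ y2 <> y3].

Lemma aut_inj g : injective g.
Proof. exact: can_inj (autK g). Qed.

Lemma aut_branch g u : branch_vertex u -> branch_vertex (g u).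
Proof.
move=> [y1 [y2 [y3 [? ? ? ? [? ?]]]]]; exists (g y1), (g y2), (g y3).
by split; rewrite ?aut_adj //; [move=> /aut_inj | split=> /aut_inj].
Qed.

(** * Displaced half-trees in a tree with a branch vertex *)

Section Branching.
Variables (M : groupClosed (aut T)) (u0 : T).
Hypotheses (trM : transports M) (u0P : branch_vertex u0).

Lemma halftree_branch x y : adj x y ->
  exists u, branch_vertex u /\ halftree x y u.
Proof.
move=> xy; have [y1 [_ [_ [uy1 _ _ _ _]]]] := u0P.
have [m _ mP] := trM xy (adjC uy1).
by exists (m u0); split; [exact: aut_branch | exact/mP/halftree_head/adjC].
Qed.

(** Images of [u0] and of one of its neighbours lie in [halftree x y]; one of them differs from [y],
    and the step from [y] towards it leads away from [x]. *)
Lemma no_leaf x y : adj x y -> exists2 y', adj y y' & y' <> x.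
Proof.
move=> xy; have [y1 [y2 [y3 [uy1 uy2 _ n12 _]]]] := u0P.
have [m _ mP] := trM xy (adjC uy1).
have hu : halftree x y (m u0) by exact/mP/halftree_head/adjC.
have hy2 : halftree x y (m y2).
  apply: mP; apply: contrapT => /(halftree_notin (adjC uy1)) H.
  by case: n12; apply: halftree_step H (halftree_head _).
have [z hz zy] : exists2 z, halftree x y z & y <> z.
  have [E|] := EM (y = m u0); last by exists (m u0).
  exists (m y2) => //; rewrite E => /aut_inj E2.
  by move: uy2; rewrite -E2 adj_irr.
have [y' yy' hy'] := halftree_toward zy; exists y' => // E; subst y'.
exact: (halftree_notin_opp hz hy').
Qed.

(** For a common vertex [z], [u] would lie between [z] and [g u], and [g u] between [z] and [u]. *)
Lemma disjoint_halftrees g u y : adj u y -> u <> g u ->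
  ~ halftree u y (g u) -> ~ halftree (g u) (g y) u ->
  forall z, halftree u y z -> ~ halftree (g u) (g y) z.
Proof.
move=> uy ugu; have guy := aut_adjP g uy.
move=> /(halftree_notin uy) h1 /(halftree_notin guy) h2 z hz hgz.
have := dist_cross uy hz h1; have := dist_halftree uy hz.
have := dist_cross guy hgz h2; have := dist_halftree guy hgz.
move=> ? ? ? ?; suff : dist u (g u) = 0 by move/dist_eq0.
by rewrite distC; lia.
Qed.

Lemma moved_vertex g : g <> 1%g -> exists x, x <> g x.
Proof.
move=> g1; apply: contrapT => /forallNP fixed; apply: g1; apply: val_inj.
by apply: sym_ext => x; have /contrapT/esym := fixed x.
Qed.

(* A half-tree at a moved vertex x and not containing g x contains no fixed
   vertex, whereas every half-tree contains a branch vertex. *)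
Lemma moved_branch_vertex g : g <> 1%g ->
  exists u, branch_vertex u /\ u <> g u.
Proof.
move=> /moved_vertex [x xgx]; apply: contrapT => nex.
have fixb p : branch_vertex p -> g p = p.
  by move=> bp; apply: contrapT => gp; apply: nex; exists p; split => // /esym.
have [y1 xy1 _] := halftree_toward xgx.
have [y2 xy2 n12] := no_leaf (adjC xy1).
have stay y : adj x y -> ~ halftree x y (g x) -> False.
  move=> xy /(halftree_notin xy) hgx.
  have [p [/fixb gp hp]] := halftree_branch xy.
  have := dist_cross xy hp hgx; have := dist_halftree xy hp.
  rewrite -{3}gp aut_dist => -> [] E; apply: xgx.
  by apply: dist_eq0; lia.
have [h1|] := EM (halftree x y1 (g x)); last exact: stay.
apply: (stay y2) => // h2; apply: n12; exact: halftree_step h2 h1.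
Qed.

(** Among three neighbours of a moved branch vertex [u], at most one leads towards [g u] and at most
    one towards [g^-1 u]; the third gives the half-tree. *)
Lemma displaced_halftree g : g <> 1%g -> exists x y, adj x y /\
  forall z, halftree x y z -> ~ halftree (g x) (g y) z.
Proof.
move=> /moved_branch_vertex [u [[y1 [y2 [y3 []]]]]].
move=> uy1 uy2 uy3 n12 [n13 n23] ugu.
suff [y [uy h1 h2]] : exists y, [/\ adj u y, ~ halftree u y (g u) &
    ~ halftree u y ((g^-1%g : aut T) u)].
  exists u, y; split => //; apply: disjoint_halftrees => //.
  by rewrite -{2}(autVK g u) aut_halftree.
have one v y y' : adj u y -> adj u y' -> y <> y' ->
    halftree u y v -> ~ halftree u y' v.
  by move=> ? ? + ? ?; apply; exact: (@halftree_step u y y' v).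
apply: contrapT => nex.
have bad y : adj u y -> halftree u y (g u) \/ halftree u y ((g^-1%g : aut T) u).
  move=> uy; apply: contrapT => nor; apply: nex; exists y.
  by split => // ?; apply: nor; [left|right].
case: (bad _ uy1) => h1; case: (bad _ uy2) => h2; case: (bad _ uy3) => h3;
  by [case: (one _ _ _ uy1 uy2 n12 h1) | case: (one _ _ _ uy1 uy3 n13 h1)
     | case: (one _ _ _ uy2 uy3 n23 h2)].
Qed.

(** If [n] displaces a half-tree and [m] carries the complement of that half-tree into
    [halftree x y], then [m n m^-1] flips [(x, y)]. *)
Lemma transports_normal N n : normalised_by N M -> n \in N -> n <> 1%g ->
  transports N.
Proof.
move=> nNM Nn /displaced_halftree [a [b [ab dP]]].
apply: flips_transports => x y xy.
have [m Mm mP] := trM xy (adjC ab).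
exists (n ^ m^-1)%g; first by rewrite nNM // gpredVr.
move=> z yxz; rewrite conjgE invgK !autM; apply: (mP).
apply: (halftree_notin ab) => H; case: (dP _ H).
rewrite aut_halftree; apply: (halftree_notin (adjC ab)) => /mP; rewrite autVK.
exact: halftree_notin_opp.
Qed.

End Branching.
End Halves.

(** * Infinite paths, invariant subtrees and invariant ends *)

Section Paths.
Variable T : tree.
Implicit Types (u v w x y z a b : T) (c : nat -> T).

(** By [halftree_cut] a first exit would retrace the edge, so the path would have returned to
    [c i.+1], against the induction hypothesis or the absence of backtracking. *)
Lemma infinite_path_halftree c i t :
  infinite_path c -> halftree (c i) (c i.+1) (c (t.+1 + i)).
Proof.
move=> cP; elim/ltn_ind: t i => [[|t] IH] i; have [ci ci2] := cP i.
  exact: halftree_head.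
apply: contrapT => H; have [ci1 _] := cP (t.+1 + i).
have [E E'] := halftree_cut ci ci1 (IH t (ltnSn t) i) H.
case: t IH E E' {H ci1} => [|t] IH E E'; first by rewrite -E' eqxx in ci2.
have := IH t (ltnW (ltnSn _)) i.+1.
have -> : t.+1 + i.+1 = t.+2 + i by lia.
by rewrite E /halftree /= dist0.
Qed.

Lemma infinite_path_inj c : infinite_path c -> injective c.
Proof.
move=> cP; suff lt i j : i < j -> c i <> c j.
  by move=> i j cij; case: (ltngtP i j) => // /lt; rewrite cij.
move=> ij cij; have := @infinite_path_halftree c i (j - i).-1 cP.
have -> : (j - i).-1.+1 + i = j by lia.
by rewrite -cij /halftree /= dist0.
Qed.

Lemma geodesic_between u v p w : path adj u p -> last u p = v ->
  size p = dist u v -> w \in p -> dist u v = dist u w + dist w v.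
Proof.
move=> + + + wp; case/splitPr: wp => p1 p2.
rewrite cat_path last_cat size_cat /=.
move=> /and3P[up1 p1w wp2] pv E.
have := dist_min wp2.
have /dist_min : path adj u (rcons p1 w) by rewrite rcons_path up1.
have := dist_triangle u w v; rewrite last_rcons size_rcons pv; lia.
Qed.

Lemma halftree_between x y u v w :
  adj x y -> halftree x y u -> halftree x y v ->
  dist u v = dist u w + dist w v -> halftree x y w.
Proof.
move=> xy hu hv E; apply: contrapT => /(halftree_notin xy) hw.
have := dist_cross xy hu hw; have := dist_cross xy hv hw.
have := dist_triangle u y v; rewrite [dist v w]distC [dist v y]distC; lia.
Qed.

(** * Pairwise meeting translates of a half-tree *)

Section Pencil.
Variables (G : groupClosed (aut T)) (x0 y0 : T).
Hypothesis xy0 : adj x0 y0.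
Implicit Types (g m n : aut T).
Let translate m : set T := halftree (m x0) (m y0).

Lemma translate_aut g m z : translate (g * m)%g (g z) <-> translate m z.
Proof. exact: aut_halftree. Qed.

Let xym m : adj (m x0) (m y0). Proof. exact: aut_adjP. Qed.

Let core := [set z | forall m : aut T, m \in G -> translate m z].

Lemma core_subtree : subtree core.
Proof.
move=> u v cu cv; have [p [up pv E]] := dist_path u v; exists p; split => //.
move=> w wp m Gm; apply: (halftree_between (xym m) (cu m Gm) (cv m Gm)).
exact: geodesic_between up pv E wp.
Qed.

Lemma core_stable : stabilises_subtree G core.
Proof.
have sub g z : g \in G -> core z -> core (g z).
  move=> Gg cz m Gm; rewrite -[m](mulVKg g); apply/translate_aut; apply: cz.
  by rewrite gpredM // gpredVr.
move=> g Gg; apply/seteqP; split=> [_ [z cz <-]|z cz]; first exact: sub.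
exists ((g^-1%g : aut T) z); last exact: autVK.
by apply: sub => //; rewrite gpredVr.
Qed.

Hypothesis meet : forall m n : aut T, m \in G -> n \in G ->
  exists z, translate m z /\ translate n z.
Hypothesis core0 : forall z, ~ core z.

(* w is the neighbour of v towards the end defined by the translates. *)
Definition points v w := adj v w /\
  exists2 m : aut T, m \in G & translate m `<=` halftree v w.

(** Some translate misses [v]. Geodesics from [v] into it enter at [m y0], so all of it lies beyond
    the first step towards [m y0]. *)
Lemma points_ex v : exists w, points v w.
Proof.
have [m Gm mv] : exists2 m : aut T, m \in G & ~ translate m v.
  apply: contrapT => H; apply: (core0 (z := v)) => m Gm.
  by apply: contrapT => ?; apply: H; exists m.
have vm : v <> m y0 by move=> E; apply: mv; rewrite E; exact: halftree_head.
have [w vw hw] := halftree_toward vm.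
exists w; split => //; exists m => // z mz.
have := dist_cross (xym m) mz (halftree_notin (xym m) mv).
have := dist_cross (xym m) (halftree_head (xym m)) (halftree_notin (xym m) mv).
have := dist_triangle z (m y0) w; move: hw; rewrite /halftree /= dist0; lia.
Qed.

(** Here pairwise meeting enters; a common vertex [z] then makes [points] single-valued, asymmetric
    and total on edges. *)
Lemma points_meet v w v' w' : points v w -> points v' w' ->
  exists z, halftree v w z /\ halftree v' w' z.
Proof.
move=> [_ [m Gm mS]] [_ [n Gn nS]]; have [z [/mS ? /nS ?]] := meet Gm Gn.
by exists z.
Qed.

Lemma points_fun v w w' : points v w -> points v w' -> w = w'.
Proof.
move=> vw vw'; have [z [hw hw']] := points_meet vw vw'.
exact: halftree_step vw.1 vw'.1 hw hw'.
Qed.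

Lemma points_asym v w : points v w -> ~ points w v.
Proof.
move=> vw wv; have [z [h h']] := points_meet vw wv.
exact: halftree_notin_opp h' h.
Qed.

Lemma points_total v w : adj v w -> points v w \/ points w v.
Proof.
move=> vw; have [w' vw'] := points_ex v; have [v' wv'] := points_ex w.
have [z [h h']] := points_meet vw' wv'.
have [H|/(halftree_notin vw) H] := EM (halftree v w z).
  by left; rewrite (halftree_step vw vw'.1 H h).
by right; rewrite (halftree_step (adjC vw) wv'.1 H h').
Qed.

Lemma points_aut g v w : g \in G -> points v w -> points (g v) (g w).
Proof.
move=> Gg [vw [m Gm mS]]; split; first exact: aut_adjP.
exists (g * m)%g; first exact: gpredM.
move=> z; rewrite -(autVK g z) => /translate_aut /mS.
by move/(aut_halftree g).
Qed.

Definition pointing_path c := forall i, points (c i) (c i.+1).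

Lemma pointing_infinite c : pointing_path c -> infinite_path c.
Proof.
move=> cP i; split; first by case: (cP i).
by apply/eqP => E; apply: (points_asym (cP i)); rewrite E; exact: cP.
Qed.

(** Induction along a walk from [c 0] to [c' 0]: an edge pointing forward is already the first step
    of [c], so [c] is shortened; an edge pointing back is prepended to [c]. *)
Lemma pointing_merge c c' :
  pointing_path c -> pointing_path c' -> exists i j, c i = c' j.
Proof.
move=> cP; have [p] := adj_conn (c 0) (c' 0).
elim: p c c' cP => [|w p IH] c c' cP /=; first by move=> _ E _; exists 0, 0.
case/andP=> cw wp pc' c'P; have [cw'|wc] := points_total cw.
  have w1 : w = c 1 by exact: points_fun cw' (cP 0).
  have [|||i [j E]] := IH (c \o S) c' _ _ _ c'P; rewrite /= -?w1 //.
    by move=> i; exact: cP.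
  by exists i.+1, j.
have [|||i [j E]] :=
  IH (fun i => if i is j.+1 then c j else w) c' _ _ _ c'P => //.
  by case.
case: i E => [|i] E; last by exists i, j.
by exists 0, j.+1; apply: points_fun wc _; move: E => /= ->; exact: c'P.
Qed.

Lemma pointing_shift c c' i j t : pointing_path c -> pointing_path c' ->
  c i = c' j -> c (t + i) = c' (t + j).
Proof.
move=> cP c'P E; elim: t => // t IH.
by apply: points_fun (cP (t + i)) _; rewrite IH; exact: c'P.
Qed.

Lemma pointing_equiv c c' :
  pointing_path c -> pointing_path c' -> end_equiv c c'.
Proof.
move=> cP c'P; have [i0 [j0 E0]] := pointing_merge cP c'P.
have ex : exists i, `[< range c' (c i) >].
  by exists i0; apply/asboolP; exists j0.
(* From the first meeting index [a] on, both paths follow [points] and agree, so their intersection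
   is exactly the tail of [c] at [a]. *)
case: (ex_minnP ex) => a /asboolP [j _ E] amin.
exists (fun t => c (t + a)); split.
  by apply: pointing_infinite => t; exact: cP.
apply/seteqP; split=> [_ [t _ <-]|_ [[i _ <-] c'i]].
  split; first by exists (t + a).
  by exists (t + j); rewrite // (pointing_shift t c'P cP E).
have /amin ai : `[< range c' (c i) >] by exact/asboolP.
by exists (i - a) => //; rewrite subnK.
Qed.

(** After one step against [points], absence of backtracking forces every later step against it;
    such a path meets [c] at boundedly many indices, too few to contain [d]. *)
Lemma equiv_pointing c c' : pointing_path c -> infinite_path c' ->
  end_equiv c c' -> pointing_path c'.
Proof.
move=> cP c'P [d [dP dE]]; apply: contrapT => /existsNP [j Nj].
have away i : points (c' (i + j).+1) (c' (i + j)).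
  elim: i => [|i IH]; first by have [//|] := points_total (c'P j).1.
  have [H|//] := points_total (c'P (i.+1 + j)).1.
  by have := (c'P (i + j)).2; rewrite (points_fun IH H) eqxx.
have meets i (a : nat) : c' (i + j) = c a -> c' j = c (i + a).
  elim: i a => // i IH a E; have -> : i.+1 + a = i + a.+1 by lia.
  by apply: IH; apply: points_fun (away i) _; rewrite -addSn E; exact: cP.
(* Any meeting beyond [j] can be followed along [points] back to [c' j], which has only one index on
   [c]. *)
have [K KP] : exists K, forall i (a : nat), c' i = c a -> i <= K.
  have [[k kP]|H] := EM (exists k, c' j = c k).
    exists (k + j) => i a E; have [//|ij] := leqP i j; first by lia.
    have := meets (i - j) a; rewrite subnK; last exact: ltnW.
    move=> /(_ E); rewrite kP.
    by move=> /(infinite_path_inj (pointing_infinite cP)); lia.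
  exists j => i a E; rewrite leqNgt; apply/negP => ij; apply: H.
  by exists (i - j + a); apply: meets; rewrite subnK // ltnW.
have fin : finite_set (c' @` `I_K.+1) by apply: finite_image; exact: finite_II.
have /(finite_preimage (f := d)) : finite_set (c' @` `I_K.+1) by [].
have -> : d @^-1` (c' @` `I_K.+1) = setT.
  apply/seteqP; split => // t _.
  have : (range c `&` range c') (d t) by rewrite -dE; exists t.
  move=> [[a _ E] [i _ E']].
  by exists i => //=; rewrite ltnS; apply: (KP _ a); rewrite E.
by move=> H; apply: infinite_nat; apply: H => s t _ _; exact: infinite_path_inj.
Qed.

Lemma stable_end v : exists b : set (nat -> T), is_end b /\ stabilises_end G b.
Proof.
have [phi phiP] := choice points_ex.
pose c i := iter i phi v; have cP : pointing_path c by move=> i; exact: phiP.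
exists [set c' | infinite_path c' /\ end_equiv c c']; split.
  by exists c => //; exact: pointing_infinite.
move=> g Gg c' [c'inf /(equiv_pointing cP c'inf) c'P].
have gc'P : pointing_path (g \o c') by move=> i; exact: points_aut.
by split; [exact: pointing_infinite | exact: pointing_equiv].
Qed.

End Pencil.

Lemma endless_minimal_flips (G : groupClosed (aut T))
  (hsubtree : ~ exists Y : set T,
     [/\ subtree Y, Y !=set0, Y <> setT & stabilises_subtree G Y])
  (hend : ~ exists b : set (nat -> T), is_end b /\ stabilises_end G b) :
  flips G.
Proof.
move=> x y xy; apply: contrapT => nflip.
have yx := adjC xy.
have meet (m n : aut T) : m \in G -> n \in G -> exists z,
    halftree (m y) (m x) z /\ halftree (n y) (n x) z.
  move=> Gm Gn; apply: contrapT => H; apply: nflip.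
  (* Disjointness of the translates by [m] and [n] says that [n^-1 m] moves [halftree y x] off
     itself. *)
  exists (n^-1 * m)%g; first by rewrite gpredM // gpredVr.
  move=> z yxz; apply: (halftree_notin yx) => yxmz; apply: H; exists (m z).
  split; first by apply/aut_halftree.
  by move/(aut_halftree n): yxmz; rewrite autM autVK.
pose core := [set z | forall m : aut T, m \in G -> halftree (m y) (m x) z].
have [[z cz]|ncore] := EM (core !=set0).
  apply: hsubtree; exists core; split.
  - exact: core_subtree.
  - by exists z.
  - move=> E; have : [set: T] y by [].
    rewrite -E => Ey; have := Ey 1%g gpred1.
    exact: (halftree_notin_opp (halftree_head xy)).
  - exact: core_stable.
apply: hend; apply: (stable_end yx meet _ x) => z cz.
by apply: ncore; exists z.
Qed.

End Paths.

(** * Integer powers in a group *)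

Section IntegerPowers.
Variable gT : groupType.
Implicit Types x y : gT.

Definition zexpg x (q : int) : gT :=
  match q with Posz k => x ^+ k | Negz k => x ^- k.+1 end%g.

Lemma zexpgS x q : zexpg x (q + 1)%R = (x * zexpg x q)%g.
Proof.
case: q => [k|[|k]].
- by rewrite -PoszD addn1 /= expgS.
- by rewrite /= expg1 mulgV.
- have -> : (Negz k.+1 + 1 = Negz k)%R by lia.
  by rewrite /= [in RHS]expgSr invgM mulVKg.
Qed.
End IntegerPowers.

(** * Translations and their axes *)

Section Axis.
Variable T : tree.
Implicit Types (u v w x y z a b p q : T) (c : int -> T) (g h m n : aut T).
Implicit Types (M N : groupClosed (aut T)).

Definition translation_axis h (k : nat) c :=
  [/\ 0 < k, biinfinite_path c & forall i, h (c i) = c (i + k%:Z)%R].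

Lemma geodesic_fun u v : exists f : nat -> T,
  [/\ f 0 = u, f (dist u v) = v & forall i, i < dist u v -> adj (f i) (f i.+1)].
Proof.
have [p [up pv <-]] := dist_path u v; exists (nth u (u :: p)); split => //.
  by rewrite -[LHS](last_nth u).
by move=> i ip; move/(pathP u): up => /(_ i ip).
Qed.

Lemma walk_dist (f : nat -> T) l i : (forall i, i < l -> adj (f i) (f i.+1)) ->
  dist (f 0) (f l) = l -> i <= l -> dist (f 0) (f i) = i.
Proof.
move=> adjf E il.
have le j t : j + t <= l -> dist (f j) (f (j + t)) <= t.
  elim: t => [|t IH]; first by rewrite addn0 dist0.
  rewrite addnS => jt; have := dist_triangle (f j) (f (j + t)) (f (j + t).+1).
  by rewrite (dist_adj (adjf _ jt)); have := IH (ltnW jt); lia.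
have := le 0 i il; have := le i (l - i); rewrite subnKC // => /(_ (leqnn l)).
have := dist_triangle (f 0) (f i) (f l); rewrite add0n; lia.
Qed.

Lemma translation_axis_exists h x y : adj x y ->
  halftree x y (h x) -> halftree (h y) (h x) x ->
  exists k c, translation_axis h k c.
Proof.
move=> xy xyhx hyx.
have [f [f0 fd fadj]] := geodesic_fun y (h x).
set d := dist y (h x) in fd fadj.
(* [c0] is a geodesic from [x] through [y] and [h x] to [h y]; the extra edge past [h x] rules out
   backtracking where consecutive translates are glued. *)
pose c0 i := if i is j.+1 then if j <= d then f j else h y else x.
have c01 : c0 1 = y by [].
have c0n : c0 d.+1 = h x by rewrite /= leqnn.
have c0nS : c0 d.+2 = h y by rewrite /= ltnn.
have c0adj i : i < d.+2 -> adj (c0 i) (c0 i.+1).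
  case: i => [_|i]; first by rewrite c01.
  rewrite ltnS leq_eqVlt => /orP[/eqP ->|id].
    by rewrite c0n c0nS aut_adj.
  by rewrite /= ltnS in id *; rewrite (ltnW id) id; exact: fadj.
have c0dist i : i <= d.+2 -> dist x (c0 i) = i.
  apply: (@walk_dist c0) => //; rewrite c0nS /=.
  rewrite (dist_halftree (aut_adjP h (adjC xy)) hyx); congr _.+1.
  by rewrite distC (dist_halftree xy xyhx) distC.
pose k := d.+1.
pose c (i : int) := (zexpg h (i %/ k)%Z : aut T) (c0 `|(i %% k)%Z|%N).
have ck i : c (i + k%:Z)%R = h (c i).
  by rewrite /c divzDr ?dvdzz // divzz /= zexpgS modzDr.
have csmall i : i < k -> c (Posz i) = c0 i.
  by move=> ik; rewrite /c divz_small ?modz_small //= ?ltz_nat ?lez_nat ?ik.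
have c00 : c 0%R = x by rewrite (csmall 0).
have ck1 : c k = h x by rewrite -[Posz k]add0r ck c00.
have c1 : c 1%R = y.
  (* If [d = 0] then [k = 1], and index 1 already belongs to the next block, starting at
     [h x = y]. *)
  have [E|d0] := EM (d = 0); last by rewrite (csmall 1) //; rewrite /k; lia.
  by rewrite -[1%R]/(Posz 1) -c01; move: ck1 c0n; rewrite /k E => -> ->.
have cle i : i <= d.+2 -> c (Posz i) = c0 i.
  rewrite leq_eqVlt => /orP[/eqP ->|]; last first.
    by rewrite ltnS leq_eqVlt => /orP[/eqP ->|/csmall //]; rewrite c0n -ck1.
  by rewrite c0nS -c1 -ck; congr c; rewrite /k; lia.
have shift (q : int) : exists m : aut T, forall j, c (q * k%:Z + j)%R = m (c j).
  elim/int_ind: q => [|q [m mP]|q [m mP]].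
  - by exists 1%g => j; rewrite mul0r add0r.
  - exists (m * h)%g => j; rewrite autM -ck -mP; congr c; lia.
  - exists (m * h^-1)%g => j; rewrite autM -{2}[j](subrK (Posz k)) ck autK -mP.
    by congr c; lia.
exists k, c; split => // i.
(* An automorphism moves [i] into the first period, where three consecutive vertices of [c] lie on
   the geodesic [c0]. *)
have [m mP] := shift (i %/ k)%Z.
have [r rk ir] : exists2 r, r < k & i = ((i %/ k)%Z * k%:Z + r%:Z)%R.
  exists `|(i %% k)%Z|%N; last by rewrite gez0_abs ?modz_ge0 // -divz_eq.
  by rewrite -ltz_nat gez0_abs ?modz_ge0 // ltz_pmod.
have rd : r <= d by rewrite /k in rk.
have cr j : j <= 2 -> c (Posz r + Posz j)%R = c0 (r + j).
  by move=> j2; rewrite -PoszD cle //; lia.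
rewrite ir -!addrA !mP aut_adj cle ?cr ?addn1 ?addn2 //; last by lia.
split; first by apply: c0adj; lia.
apply/eqP => /aut_inj E.
have := c0dist r.+2; rewrite -E c0dist => [/(_ _)|]; last by lia.
by rewrite !ltnS => /(_ rd); lia.
Qed.

Lemma biinfinite_forward c i : biinfinite_path c ->
  infinite_path (fun t : nat => c (i + t%:Z)%R).
Proof.
move=> cP t; have [A B] := cP (i + t)%R.
have -> : (i + t.+1 = i + t + 1)%R by lia.
by have -> : (i + t.+2 = i + t + 2)%R by lia.
Qed.

Lemma biinfinite_backward c i : biinfinite_path c ->
  infinite_path (fun t : nat => c (i - t%:Z)%R).
Proof.
move=> cP t.
have [A _] := cP (i - Posz t.+1)%R; have [_ B] := cP (i - Posz t.+2)%R.
have E : (i - Posz t = i - Posz t.+1 + 1)%R by lia.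
have E' : (i - Posz t = i - Posz t.+2 + 2)%R by lia.
by split; [rewrite E adj_sym | rewrite E' eq_sym].
Qed.

Lemma infinite_path_neighbour (f : nat -> T) t :
  infinite_path f -> adj (f 0) (f t) -> f t = f 1.
Proof.
move=> fP; case: t => [|t] ft; first by rewrite adj_irr in ft.
apply: (halftree_step ft (fP 0).1 (halftree_head ft)).
by have := infinite_path_halftree 0 t fP; rewrite addn0.
Qed.

Lemma biinfinite_neighbour c i v :
  biinfinite_path c -> range c v -> adj (c i) v ->
  v = c (i + 1)%R \/ v = c (i - 1)%R.
Proof.
move=> cP [j _ <-] a; have [ij|ji] := lerP i j.
  left; have := @infinite_path_neighbour _ `|j - i|%N (biinfinite_forward i cP).
  have -> : (i + Posz `|j - i|%N = j)%R by lia.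
  by rewrite addr0; apply.
right; have := @infinite_path_neighbour _ `|j - i|%N (biinfinite_backward i cP).
have -> : (i - Posz `|j - i|%N = j)%R by lia.
by rewrite subr0; apply.
Qed.

Lemma biinfinite_not_full c u : biinfinite_path c -> branch_vertex u ->
  exists v, ~ range c v.
Proof.
move=> cP [y1 [y2 [y3 [uy1 uy2 uy3 n12 [n13 n23]]]]].
apply: contrapT => /forallNP full; have {}full v : range c v by exact: contrapT.
have [i _ ci] := full u; rewrite -ci in uy1 uy2 uy3.
have := biinfinite_neighbour cP (full y1) uy1.
have := biinfinite_neighbour cP (full y2) uy2.
have := biinfinite_neighbour cP (full y3) uy3.
move=> [E3|E3] [E2|E2] [E1|E1];
  by [case: n12; rewrite E1 E2 | case: n13; rewrite E1 E3
     | case: n23; rewrite E2 E3].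
Qed.

Lemma walk_halftree (f : nat -> T) q p t :
  adj q p -> infinite_path f -> f 0 = p ->
  (forall i, f i <> q) -> halftree q p (f t).
Proof.
move=> qp fP f0 fq; elim: t => [|t IH].
  by rewrite f0; exact: halftree_head.
apply: contrapT => H; have [_] := halftree_cut qp (fP t).1 IH H.
exact: fq.
Qed.

(** A walk from the path to [v] leaves it along some edge from [p] to [q]; the path avoids [q], so
    it stays on the side of [p]. *)
Lemma biinfinite_halftree c v : biinfinite_path c -> ~ range c v ->
  exists q p, adj q p /\ forall i, halftree q p (c i).
Proof.
move=> cP cv.
have [q [p [qp cq [i0 _ ci0]]]] :
    exists q p, [/\ adj q p, ~ range c q & range c p].
  have : range c (c 0%R) by exists 0%R.
  have [l] := adj_conn (c 0%R) v; elim: l (c 0%R) => [|w l IH] u /=.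
    by move=> _ -> /cv.
  case/andP=> uw wl lv cu.
  have [cw|ncw] := EM (range c w); first exact: IH lv cw.
  by exists w, u; split => //; exact: adjC.
exists q, p; split => // i.
have ne j : c j <> q by move=> E; apply: cq; exists j.
have [ij|ji] := lerP i0 i.
  have -> : i = (i0 + Posz `|i - i0|%N)%R by lia.
  apply: (walk_halftree _ qp (biinfinite_forward i0 cP)) => //.
  by rewrite addr0.
have -> : i = (i0 - Posz `|i - i0|%N)%R by lia.
by apply: (walk_halftree _ qp (biinfinite_backward i0 cP)) => //; rewrite subr0.
Qed.

Lemma translation_axis_conj g h k c : translation_axis h k c ->
  translation_axis (h ^ g^-1)%g k (g \o c).
Proof.
move=> [k0 cP hc]; split => // i.
  have [A B] := cP i; rewrite /= aut_adj; split => //.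
  by apply: contra B => /eqP /aut_inj ->.
by rewrite conjgE invgK !autM autK /= hc.
Qed.

Lemma translation_axis_in_halftree M N n u : transports M -> branch_vertex u ->
  normalised_by N M -> n \in N -> n <> 1%g ->
  forall x y, adj x y -> exists2 h : aut T, h \in N &
    exists k c, translation_axis h k c /\ forall i, halftree x y (c i).
Proof.
move=> trM uP nNM Nn n1 x y xy.
have [a [b [ab dP]]] := displaced_halftree trM uP n1.
(* [halftree b b'] lies inside [halftree a b] and omits [b]; below, [m] carries the complement of
   the larger into the smaller. *)
have [b' bb' b'a] := no_leaf trM uP ab.
have sub z : halftree b b' z -> halftree a b z.
  move=> h; apply: contrapT => /(halftree_notin ab) h'.
  by apply: b'a; exact: halftree_step bb' (adjC ab) h h'.
have [m Mm mP] := trM _ _ _ _ bb' (adjC ab).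
have mV z : ~ halftree b b' z -> halftree a b ((m^-1%g : aut T) z).
  move=> nz; apply: contrapT => /(halftree_notin ab) /mP; rewrite autVK.
  exact: nz.
have nA z : halftree a b z -> halftree b a (n z).
  move=> az; apply: (halftree_notin ab) => H; apply: (dP _ H).
  by apply/aut_halftree.
have nV z : halftree a b z -> halftree b a ((n^-1%g : aut T) z).
  move=> az; apply: (halftree_notin ab) => /nA; rewrite autVK => H.
  exact: (halftree_notin_opp H).
(* The commutator [n m n^-1 m^-1], written as [n] times a conjugate of [n^-1] to show that it lies
   in [N]. *)
pose h : aut T := (n * (n^-1 ^ m^-1))%g.
have Nh : h \in N by rewrite gpredM // nNM ?gpredVr.
have hE z : h z = n (m ((n^-1%g : aut T) ((m^-1%g : aut T) z))).
  by rewrite /h conjgE invgK !autM.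
have hVE z : (h^-1%g : aut T) z = m (n ((m^-1%g : aut T) ((n^-1%g : aut T) z))).
  by rewrite /h invgM conjVg invgK conjgE invgK !autM.
have bF : ~ halftree b b' b by rewrite /halftree /= dist0.
have naF : ~ halftree b b' (n a).
  move=> H; have [E _] := halftree_cut ab (aut_adjP n ab) (sub _ H)
    (halftree_notin_opp (nA _ (halftree_head ab))).
  by rewrite E in H.
have aF : ~ halftree b b' a.
  by move/sub; exact: (halftree_notin_opp (halftree_head (adjC ab))).
have [k [c hc]] : exists k c, translation_axis h k c.
  apply: (translation_axis_exists (aut_adjP n ab)).
    by rewrite hE aut_halftree; apply/sub/mP/nV/mV.
  apply: (halftree_notin (aut_adjP h (aut_adjP n ab))).
  rewrite -{2}(autVK h (n a)) aut_halftree; apply: dP; rewrite hVE autK.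
  by apply/sub/mP/nA/mV.
(* The branch vertex keeps the axis from filling the tree, so the axis lies in some half-tree, which
   [M] transports into the prescribed one. *)
have [v cv] := biinfinite_not_full (let: And3 _ cP _ := hc in cP) uP.
have [q [p [qp cqp]]] := biinfinite_halftree (let: And3 _ cP _ := hc in cP) cv.
have [g Mg gP] := trM _ _ _ _ xy qp.
exists (h ^ g^-1)%g; first by rewrite nNM // gpredVr.
exists k, (g \o c); split; first exact: translation_axis_conj.
by move=> i; apply: gP.
Qed.

End Axis.

(** * Generated subgroups and abstract simplicity *)

Section Subgroups.
Variable gT : groupType.
Implicit Types (H K : groupClosed gT).

(** Being a subgroup, it lets closure under conjugation be checked on generators. *)
Definition conj_preim (g : gT) K : {pred gT} := [pred x | (x ^ g)%g \in K].

Fact conj_preim_closed g K : group_closed (conj_preim g K).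
Proof.
split=> [|x y]; first by rewrite inE conj1g gpred1.
by rewrite !inE conjMg conjVg; exact: gpredF.
Qed.

HB.instance Definition _ g K := isMulClosed.Build gT (conj_preim g K)
  (group_closedM (conj_preim_closed g K)).
HB.instance Definition _ g K :=
  isMul1Closed.Build gT (conj_preim g K) (conj_preim_closed g K).1.
HB.instance Definition _ g K := isInvClosed.Build gT (conj_preim g K)
  (group_closedV (conj_preim_closed g K)).

Lemma mem_generated (S : set gT) x : S x -> x \in generated S.
Proof. by move=> Sx; apply/asboolP => H; apply. Qed.

Lemma generated_sub (S : set gT) H :
  (forall x, S x -> x \in H) -> {subset generated S <= H}.
Proof. by move=> SH x /asboolP; apply. Qed.

Lemma generated_normalised (S : set gT) H :
  (forall x g, g \in H -> S x -> S (x ^ g)%g) -> normalised_by (generated S) H.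
Proof.
move=> SH.
have sub g : g \in H -> {subset generated S <= conj_preim g (generated S)}.
  by move=> Hg; apply: generated_sub => x Sx; apply: mem_generated; exact: SH.
move=> g h Hg; apply/idP/idP => [|/(sub g Hg)//].
by move/(sub _ (gpredVr _ Hg)) => ?; rewrite -[h](conjgK g).
Qed.

Definition subgroup_image H (N : groupClosed (elt H)) : {pred gT} :=
  [pred x | `[< exists2 y : elt H, y \in N & val y = x >]].

Fact subgroup_image_closed H (N : groupClosed (elt H)) :
  group_closed (subgroup_image N).
Proof.
split=> [|x y /asboolP[x' Nx' <-] /asboolP[y' Ny' <-]]; apply/asboolP.
  by exists 1%g; first exact: gpred1.
by exists (x' / y')%g; first exact: gpredF.
Qed.

HB.instance Definition _ H N := isMulClosed.Build gT (@subgroup_image H N)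
  (group_closedM (subgroup_image_closed N)).
HB.instance Definition _ H N :=
  isMul1Closed.Build gT (@subgroup_image H N) (subgroup_image_closed N).1.
HB.instance Definition _ H N := isInvClosed.Build gT (@subgroup_image H N)
  (group_closedV (subgroup_image_closed N)).

(** A normal subgroup of the abstract group [elt H] becomes, through [subgroup_image], a subgroup of
    [gT] normalised by [H]. *)
Lemma simple_or_trivial H :
  (forall K, {subset K <= H} -> (exists2 x, x \in K & x != 1%g) ->
     normalised_by K H -> {subset H <= K}) ->
  simple_group (elt H) \/ trivial_group (elt H).
Proof.
move=> HP; have [triv|ntriv] := EM (trivial_group (elt H)); [by right | left].
split=> // N nN; have [?|] := EM (forall x, x \in N -> x = 1%g); first by left.
move=> /existsNP[x /not_implyP[Nx x1]].
right=> y; have : val y \in subgroup_image N.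
  apply: (HP _ _ _ _ _ (valP y)).
  - by move=> _ /asboolP[z _ <-]; exact: valP.
  - exists (val x); first by apply/asboolP; exists x.
    by apply/eqP => E; apply: x1; exact: val_inj.
  move=> g h Hg; have imJ g' h' : g' \in H -> h' \in subgroup_image N ->
      (h' ^ g')%g \in subgroup_image N.
    move=> Hg' /asboolP[z Nz <-]; apply/asboolP.
    by exists (z ^ (exist _ g' Hg' : elt H))%g; first by rewrite nN.
  apply/idP/idP; last exact: imJ.
  by move/(imJ _ _ (gpredVr _ Hg)); rewrite conjgK.
by move=> /asboolP[z Nz /val_inj <-].
Qed.

End Subgroups.

(** * Projection onto an edge and onto an axis *)

Section ClosestVertex.
Variable T : tree.
Implicit Types (u v w x y z : T) (C : set T).

Lemma closest_vertexP C z : C !=set0 -> C (closest_vertex C z) /\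
  forall y, C y -> dist z (closest_vertex C z) <= dist z y.
Proof.
move=> [x Cx]; rewrite /closest_vertex; case: xgetP => [y _ //|none]; exfalso.
have ex : exists d, `[< exists2 y, C y & dist z y = d >].
  by exists (dist z x); apply/asboolP; exists x.
case: (ex_minnP ex) => d /asboolP[y Cy yd] dmin.
apply: (none y); split => // y' Cy'.
by rewrite yd dmin //; apply/asboolP; exists y'.
Qed.

Lemma closest_vertex_edge v w z :
  halftree w v z -> closest_vertex [set v; w] z = v.
Proof.
have [|[//|->] /(_ v)] := @closest_vertexP [set v; w] z.
  by exists v; left.
by move=> H hz; move: hz (H (or_introl erefl)); rewrite /halftree /=; lia.
Qed.

Lemma biinfinite_inj (c : int -> T) : biinfinite_path c -> injective c.
Proof.
move=> cP; suff le i j : (i <= j)%R -> c i = c j -> i = j.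
  by move=> i j E; have [/le|/ltW/le] := lerP i j; [apply | move=> ->].
move=> ij E.
have := @infinite_path_inj _ _ (biinfinite_forward i cP) 0 `|j - i|%N.
have -> : (i + Posz `|j - i|%N = j)%R by lia.
by rewrite addr0 => /(_ E); lia.
Qed.

(** If [c a] is closest to [z] and [a < b], then [c b] lies beyond the edge from [c a] to
    [c (a + 1)] and [z] does not, so [c b] is strictly farther. *)
Lemma closest_on_biinfinite_unique (c : int -> T) z i j : biinfinite_path c ->
  (forall l, dist z (c i) <= dist z (c l)) ->
  (forall l, dist z (c j) <= dist z (c l)) -> i = j.
Proof.
move=> cP; suff lt a b :
    (a < b)%R -> (forall l, dist z (c a) <= dist z (c l)) ->
    (forall l, dist z (c b) <= dist z (c l)) -> False.
  move=> Hi Hj; have [ij|ij|//] := ltgtP i j;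
    by [case: (lt i j) | case: (lt j i)].
move=> ab Ha Hb; have fP := biinfinite_forward a cP.
have cab : halftree (c (a + 0)%R) (c (a + 1%:Z)%R) (c b).
  have := infinite_path_halftree 0 `|b - a|%N.-1 fP; rewrite addn0.
  by have -> : (a + Posz `|b - a|%N.-1.+1 = b)%R by lia.
have aa := (fP 0).1; have naz : ~ halftree (c (a + 0)%R) (c (a + 1%:Z)%R) z.
  by rewrite /halftree /= addr0 => za; have := Ha (a + 1%:Z)%R; lia.
have := dist_cross (adjC aa) (halftree_notin aa naz) cab.
by rewrite addr0 => E; have := Hb a; lia.
Qed.

End ClosestVertex.

(** * Consequences of Property P_k for edges and axes *)

Section PropertyP.
Variables (T : tree) (G : groupClosed (aut T)) (k : nat).
Hypotheses (k_gt0 : 0 < k) (hP : property_P G k).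
Implicit Types (u v w x y z : T) (C : set T) (f g h : aut T).

Lemma fixerP Y g :
  reflect (g \in G /\ forall v, Y v -> g v = v) (g \in fixer G Y).
Proof.
apply: (iffP andP) => -[Gg]; first by move/asboolP.
by move=> ?; split=> //; apply/asboolP.
Qed.

(** This is surjectivity of [Phi]: fixer elements chosen independently over the vertices of [C] are
    realised fibrewise by a single one. *)
Lemma property_P_glue C (F : T -> aut T) : path_vertices C -> C !=set0 ->
  (forall x, C x -> F x \in fixer G (nbhd C k.-1)) ->
  exists2 f : aut T, f \in fixer G (nbhd C k.-1) &
    forall z, f z = F (closest_vertex C z) z.
Proof.
move=> pC C0 FP; have [_ [Psi _ PhiK]] := hP pC.
pose fam (x : C) : elt (fibre_group G C k.-1 x) :=
  Phi (exist _ (F (val x)) (FP _ (set_mem (valP x)))) x.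
exists (val (Psi fam)); first exact: valP.
move=> z; have Cx : closest_vertex C z \in C.
  by apply/mem_set; exact: (closest_vertexP z C0).1.
pose x : C := exist _ (closest_vertex C z) Cx.
have zx : z \in fibre C (val x) by exact/mem_set.
have := congr1 (fun F => val (sym_fun (val (F x)) (exist _ z zx))) (PhiK fam).
by [].
Qed.

Lemma edge_path_vertices v w : adj v w -> path_vertices [set v; w].
Proof.
move=> vw; constructor 1; exists 1, (fun i => if i is 0 then v else w); split.
  by split=> [[]|].
apply/seteqP; split=> [u [->|->]|_ [[|i] _ <-]];
  by [exists 0|exists 1|left|right].
Qed.

(** The fibres over an edge are its two half-trees; [g1] glues [g] over [v] with the identity over
    [w]. *)
Lemma fixer_split v w g : adj v w -> g \in fixer G (nbhd [set v; w] k.-1) ->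
  exists g1 g2, [/\ g = (g1 * g2)%g,
    g1 \in fixer G (nbhd [set v; w] k.-1) /\
      (forall z, halftree v w z -> g1 z = z) &
    g2 \in fixer G (nbhd [set v; w] k.-1) /\
      (forall z, halftree w v z -> g2 z = z)].
Proof.
move=> vw gP.
have [|x _|g1 g1P g1E] := @property_P_glue _
  (fun x => if x == v then g else 1%g) (edge_path_vertices vw).
- by exists v; left.
- by case: ifP => // _; exact: gpred1.
have g1v z : halftree w v z -> g1 z = g z.
  by move=> hz; rewrite g1E closest_vertex_edge // eqxx.
exists g1, (g1^-1 * g)%g; split.
- by rewrite mulVKg.
- split=> // z hz; rewrite g1E [[set v; w]]setUC closest_vertex_edge //.
  by rewrite eq_sym (negbTE (adj_neq vw)).
- split; first by rewrite gpredM // gpredVr.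
  by move=> z hz; rewrite autM -g1v // autK.
Qed.

(** [h] shifts the fibres over the axis by [n], so [f h = g^-1 h f] determines [f] recursively from
    its action on [n] consecutive fibres, taken to be trivial. *)
Lemma fixer_axis_commutator h n c g : h \in G -> translation_axis h n c ->
  g \in fixer G (nbhd (range c) k.-1) ->
  exists2 f : aut T, f \in fixer G (nbhd (range c) k.-1) &
    (h * (f * h^-1 * f^-1))%g = g.
Proof.
move=> Gh [n0 cP hc] gP; set C := range c in gP *; set K := fixer G _ in gP *.
have hC x : C (h x) <-> C x.
  split=> [[i _ E]|[i _ <-]]; last by exists (i + n%:Z)%R.
  by exists (i - n%:Z)%R => //; apply: (@aut_inj _ h); rewrite hc subrK.
have hN x : nbhd C k.-1 (h x) <-> nbhd C k.-1 x.
  split=> [[y Cy]|[y Cy yx]]; last by exists (h y); rewrite ?aut_dist // hC.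
  rewrite -(autVK h y) aut_dist in Cy *; exists ((h^-1%g : aut T) y) => //.
  by apply/hC.
have hJ f : (h * f * h^-1 \in K)%g = (f \in K).
  apply/fixerP/fixerP => -[Gf fN]; split.
  - have -> : f = (h^-1 * (h * f * h^-1) * h)%g.
      by rewrite -!mulgA mulVg mulg1 mulKg.
    by apply: gpredM => //; apply: gpredM => //; exact: gpredVr.
  - move=> x /hN /fN; rewrite !autM autK; exact: aut_inj.
  - by rewrite gpredM ?gpredVr // gpredM.
  - move=> x; rewrite -{1}(autVK h x) => /hN /fN; rewrite !autM => ->.
    by rewrite autVK.
(* If f acts on the fibre of c i as P (i div n), then it conjugates h to
   g^-1 h. *)
pose P q := (zexpg (g^-1 * h) q * (zexpg h q)^-1)%g.
have PS q : P (q + 1)%R = (g^-1 * (h * P q * h^-1))%g.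
  by rewrite /P !zexpgS invgM !mulgA.
have PK q : P q \in K.
  elim/int_ind: q => [|q IH|q IH].
  - by rewrite /P /= mulgV gpred1.
  - have -> : (Posz q.+1 = Posz q + 1)%R by lia.
    by rewrite PS gpredM ?gpredVr // hJ.
  - rewrite -hJ.
    have -> : (h * P (- Posz q.+1)%R * h^-1 = g * P (- Posz q)%R)%g.
      have -> : (- Posz q = - Posz q.+1 + 1)%R by lia.
      by rewrite PS mulVKg.
    exact: gpredM.
(* [idx] inverts [c]; its default 0 occurs only off the axis. *)
pose idx x := xget 0%R [set i | c i = x].
have idxc i : idx (c i) = i.
  apply: (biinfinite_inj cP).
  by rewrite /idx; case: xgetP => [j _ //|/(_ i) []].
have [|||f fK fE] := @property_P_glue C (fun x => P (idx x %/ n)%Z).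
- by constructor 3; exists c.
- by exists (c 0%R); exists 0%R.
- by move=> x _; exact: PK.
have fh z : f (h z) = (g^-1 * h * f : aut T)%g z.
  have C0 : C !=set0 by exists (c 0%R); exists 0%R.
  rewrite !autM !fE; have [[i _ iE] imin] := closest_vertexP z C0.
  have [[j _ jE] jmin] := closest_vertexP (h z) C0.
  (* Projection to the axis is unique and so commutes with [h]; the block index therefore grows by
     exactly one and [PS] applies. *)
  have ij : (i + n%:Z)%R = j.
    apply: (closest_on_biinfinite_unique (z := h z) cP) => l.
      rewrite -hc aut_dist -(subrK (Posz n) l) -hc aut_dist iE; apply: imin.
      by exists (l - n%:Z)%R.
    by rewrite jE; apply: jmin; exists l.
  rewrite -jE -iE !idxc -ij divzDr ?dvdzz // divzz.
  rewrite (_ : (Posz n != 0)%R) ?eqz_nat -?lt0n //=.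
  by rewrite PS !autM autK.
exists f => //.
have E : (f * h = g^-1 * h * f)%g by apply: val_inj; exact/sym_ext/fh.
have E' : (h * f = g * (f * h))%g by rewrite E -mulgA mulVKg.
by rewrite !mulgA E' !mulgA mulgK mulgK.
Qed.

(** Distances to the two ends of an edge differ by one, so a vertex in both [k]-balls is within
    [k.-1] of the nearer end. *)
Lemma fixer_Gplus C v w : adj v w -> C v -> C w ->
  {subset fixer G (nbhd C k.-1) <= Gplus G k}.
Proof.
move=> vw Cv Cw g /fixerP[Gg gC]; apply: mem_generated; split => //.
exists v, w; split => // u [uv uw]; apply: gC.
have [/(dist_halftree vw) E|] := EM (halftree v w u).
  by exists w => //; move: uv uw; rewrite /ball /= ![dist _ u]distC; lia.
move=> /(halftree_notin vw) /(dist_halftree (adjC vw)) E.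
by exists v => //; move: uv uw; rewrite /ball /= ![dist _ u]distC; lia.
Qed.

Lemma Gplus_generator_fixer v w g : adj v w -> g \in G ->
  (forall u, (ball v k `&` ball w k) u -> g u = u) ->
  g \in fixer G (nbhd [set v; w] k.-1).
Proof.
move=> vw Gg gvw; apply/fixerP; split => // u [x vwx ux]; apply: gvw.
have := dist_triangle v w u; have := dist_triangle w v u.
rewrite [dist w v]distC (dist_adj vw).
by case: vwx ux => ->; rewrite distC /ball /setI /=; lia.
Qed.

Lemma Gplus_sub : {subset Gplus G k <= G}.
Proof. by apply: generated_sub => x []. Qed.

Lemma Gplus_normalised : normalised_by (Gplus G k) G.
Proof.
apply: generated_normalised => g h Gh [Gg [v [w [vw gvw]]]]; split.
  by rewrite conjgE !gpredM // gpredVr.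
exists ((h^-1%g : aut T) v), ((h^-1%g : aut T) w); split; first exact: aut_adjP.
move=> u [/= uv uw]; rewrite conjgE !autM gvw ?autK //.
by split; rewrite /ball /= -[X in dist X _](autVK h) aut_dist.
Qed.

(* A path inside the half-tree beyond (v, w) can leave it only through v, so the
   part of its (k-1)-neighbourhood outside the half-tree is within k-1 of v. *)
Lemma fixer_halftree_nbhd v w C g : adj v w -> C `<=` halftree v w ->
  g \in fixer G (nbhd [set v; w] k.-1) ->
  (forall z, halftree v w z -> g z = z) ->
  g \in fixer G (nbhd C k.-1).
Proof.
move=> vw Cvw /fixerP[Gg gP] gvw; apply/fixerP; split => // u [x /Cvw vwx ux].
have [/gvw //|/(halftree_notin vw) wvu] := EM (halftree v w u).
apply: gP; exists v; first by left.
by have := dist_cross (adjC vw) wvu vwx; lia.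
Qed.

Lemma Gplus_contained (H : groupClosed (aut T)) u :
  transports (Gplus G k) -> branch_vertex u ->
  {subset H <= G} -> (exists2 h : aut T, h \in H & h != 1%g) ->
  normalised_by H (Gplus G k) -> {subset Gplus G k <= H}.
Proof.
move=> tr uP HG [n Hn /eqP n1] nH.
have local v w g : adj v w -> g \in fixer G (nbhd [set v; w] k.-1) ->
    (forall z, halftree v w z -> g z = z) -> g \in H.
  move=> vw gP gvw.
  have [h Hh [l [c [hc cvw]]]] :=
    translation_axis_in_halftree tr uP nH Hn n1 vw.
  have gc : g \in fixer G (nbhd (range c) k.-1).
    by apply: fixer_halftree_nbhd gP gvw => // _ [i _ <-].
  have [f fP <-] := fixer_axis_commutator (HG _ Hh) hc gc.
  have [_ cP _] := hc; have [c01 _] := cP 0%R.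
  have Pf : f \in Gplus G k.
    by apply: fixer_Gplus fP; [exact: c01 | exists 0%R | exists (0 + 1)%R].
  (* [f] lies in [Gplus G k], which normalises [H], so this conjugate of [h^-1] is in [H]. *)
  have -> : (f * h^-1 * f^-1 = h^-1 ^ f^-1)%g by rewrite conjgE invgK mulgA.
  by rewrite gpredM // nH ?gpredVr.
apply: generated_sub => g [Gg [v [w [vw gvw]]]].
have [g1 [g2 [-> [g1P g1E] [g2P g2E]]]] :=
  fixer_split vw (Gplus_generator_fixer vw Gg gvw).
apply: gpredM; first exact: local vw g1P g1E.
by apply: (local w v) (adjC vw) _ g2E; rewrite [[set w; v]]setUC.
Qed.

(** On a walk to a moved vertex, take a fixed [v] followed by a moved [v']: besides a fixed
    neighbour [w], it has the distinct neighbours [v'] and [g v']. *)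
Lemma fixed_edge_branch_vertex v w g :
  adj v w -> g v = v -> g w = w -> g <> 1%g ->
  exists u, branch_vertex u.
Proof.
move=> + + + /moved_vertex[z gz]; have [p] := adj_conn v z.
elim: p v w => [|v' p IH] v w /=; first by move=> _ -> _ /esym.
case/andP=> vv' v'p v'z vw gv gw.
have [gv'|ngv'] := EM (g v' = v'); first exact: IH v'p v'z (adjC vv') gv' gv.
exists v, w, v', (g v'); split => //.
  by rewrite -[in X in adj X]gv aut_adj.
  by move=> E; apply: ngv'; rewrite -E.
by split=> [E|/esym //]; apply: ngv'; apply: (@aut_inj _ g); rewrite -E.
Qed.

End PropertyP.

Local Open Scope group_scope.

Theorem theorem7p3 (T : tree) (k : nat) (hk : (1 <= k)%N)
  (G : groupClosed (aut T))
  (hsubtree : ~ exists Y : set T,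
     [/\ subtree Y, Y !=set0, Y <> setT & stabilises_subtree G Y])
  (hend : ~ exists b : set (nat -> T), is_end b /\ stabilises_end G b)
  (hP : property_P G k) :
  (forall H : groupClosed (aut T),
     {subset H <= G} -> (exists2 h, h \in H & h != 1) ->
     normalised_by H (Gplus G k) -> {subset Gplus G k <= H}) /\
  (simple_group (elt (Gplus G k)) \/ trivial_group (elt (Gplus G k))).
Proof.
have contains (H : groupClosed (aut T)) : {subset H <= G} ->
    (exists2 h, h \in H & h != 1) ->
    normalised_by H (Gplus G k) -> {subset Gplus G k <= H}.
  move=> HG Hn nH.
  (* A nontrivial generator supplies the branch vertex; if there is none, [Gplus G k] is trivial and
     the inclusion is immediate. *)
  have [[g [[Gg [v [w [vw gvw]]]] g1]]|triv] := EM (exists g : aut T,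
    (g \in G /\ exists v w, adj v w /\
       forall u, (ball v k `&` ball w k) u -> g u = u) /\ g <> 1).
    (* As [k >= 1], both ends of the edge lie in both balls. *)
    have gv : g v = v.
      by apply: gvw; split; rewrite /ball /= ?dist0 ?(dist_adj (adjC vw)).
    have gw : g w = w.
      by apply: gvw; split; rewrite /ball /= ?dist0 ?(dist_adj vw).
    have [u uP] := fixed_edge_branch_vertex vw gv gw g1.
    have trG := flips_transports (endless_minimal_flips hsubtree hend).
    have Pg : g \in Gplus G k by apply: mem_generated; split => //; exists v, w.
    have trP := transports_normal trG uP (@Gplus_normalised T G k) Pg g1.
    exact: Gplus_contained trP uP HG Hn nH.
  apply: generated_sub => g gP; have [->|g1] := EM (g = 1); first exact: gpred1.
  by case: triv; exists g.
split => //; apply: simple_or_trivial => K KP Kn nK.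
by apply: contains => // x /KP; exact: Gplus_sub.
Qed.
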